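(* Let $X$ be a sieve-complete completely regular Hausdorff space, and let $Z\subset \mathscr{P}(X)$ be a paracompact subspace. Then for every $\varepsilon>0$ there is an usco mapping $\varphi:Z\to\mathscr{C}(X)$ such that $\mu(X\setminus\varphi(\mu))<\varepsilon$ for every $\mu\in Z$.
   Context: All spaces are assumed to be completely regular and Hausdorff. For a space $X$, $\mathscr{B}(X)$ is the Borel $\sigma$-algebra of $X$. A Radon measure on $X$ is a countably additive function $\mu:\mathscr{B}(X)\to[0,+\infty]$ such that $\mu(B)=\sup\{\mu(K):K\subset B \text{ and } K \text{ is compact}\}$ for every $B\in\mathscr{B}(X)$; it is a Radon probability measure if in addition $\mu(X)=1$. $\mathscr{P}(X)$ denotes the set of all Radon probability measures on $X$, endowed with the weakest topology for which all functionals $\mu\mapsto\int g\,d\mu$, with $g:X\to\mathbb{R}$ bounded and continuous, are continuous; subsets of $\mathscr{P}(X)$ carry the subspace topology. $2^X$ is the family of all nonempty subsets of $X$, and $\mathscr{C}(X)$ is the family of all nonempty compact subsets of $X$. A set-valued mapping $\psi:Z\to 2^X$ is upper semi-continuous (u.s.c.) if $\{z\in Z:\psi(z)\subset U\}$ is open in $Z$ for every open $U\subset X$; it is usco if it is u.s.c. and all its values are compact. A space $X$ is sieve-complete if it has an open complete sieve, in the following sense. An open sieve on $X$ is a sequence of indexed open covers $\{U_\alpha:\alpha\in A_n\}$ of $X$, $n=0,1,2,\dots$, together with maps $\pi_n:A_{n+1}\to A_n$ such that $U_\alpha=\bigcup\{U_\beta:\beta\in\pi_n^{-1}(\alpha)\}$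 for every $n$ and every $\alpha\in A_n$. The sieve is complete if, for every sequence $(\alpha_n)$ with $\alpha_n\in A_n$ and $\pi_n(\alpha_{n+1})=\alpha_n$ for all $n$, every filter base $\mathscr{F}$ on $X$ such that each $U_{\alpha_n}$ contains some member of $\mathscr{F}$ has a cluster point in $X$ (i.e. $\bigcap\{\overline{F}:F\in\mathscr{F}\}\neq\varnothing$). *)

(* Defs.v *)
From HB Require Import structures.
From mathcomp Require Import all_boot all_order all_algebra.
From mathcomp Require Import all_classical all_reals all_analysis.

Set Implicit Arguments.
Unset Strict Implicit.
Unset Printing Implicit Defensive.

Import Order.TTheory GRing.Theory Num.Theory.
Import numFieldNormedType.Exports.

Local Open Scope classical_set_scope.
Local Open Scope ring_scope.

Section sieves.
Context (X : topologicalType).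

Record open_sieve := OpenSieve {
  sieve_index : nat -> Type ;
  sieve_set : forall n, sieve_index n -> set X ;
  sieve_proj : forall n, sieve_index n.+1 -> sieve_index n ;
  sieve_open : forall n (a : sieve_index n), open (sieve_set a) ;
  sieve_cover : forall n,
    \bigcup_(a in [set: sieve_index n]) sieve_set a = [set: X] ;
  sieve_refine : forall n (a : sieve_index n),
    sieve_set a = \bigcup_(b in @sieve_proj n @^-1` [set a]) sieve_set b }.

Definition filter_base (F : set_system X) : Prop :=
  [/\ F !=set0, forall A, F A -> A !=set0 &
      forall A B, F A -> F B -> exists2 C, F C & C `<=` A `&` B].

Definition complete_sieve (S : open_sieve) : Prop :=
  forall a : forall n, sieve_index S n,
    (forall n, sieve_proj (a n.+1) = a n) ->
  forall F : set_system X, filter_base F ->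
    (forall n, exists2 B, F B & B `<=` sieve_set (a n)) ->
  cluster F !=set0.

Definition sieve_complete : Prop := exists S : open_sieve, complete_sieve S.

End sieves.

(* The Hausdorff axiom is not part of the definition: below, paracompactness
   is only required of a subspace of the Hausdorff space of Radon probability
   measures. *)
Definition paracompact (T : topologicalType) : Prop :=
  forall U : set (set T), U `<=` open -> \bigcup_(A in U) A = [set: T] ->
  exists V : set (set T),
    [/\ V `<=` open, \bigcup_(B in V) B = [set: T],
        forall B, V B -> exists2 A, U A & B `<=` A &
        forall x : T, exists2 N : set T, nbhs x N &
          finite_set [set B | V B /\ B `&` N !=set0]].

Definition usc (T X : topologicalType) (phi : T -> set X) : Prop :=
  forall U : set X, open U -> open [set z | phi z `<=` U].

Definition usco (T X : topologicalType) (phi : T -> set X) : Prop :=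
  [/\ forall z, phi z !=set0, usc phi & forall z, compact (phi z)].

(* X equipped with its Borel sigma-algebra. Measurable types are pointed in the
   library, whence the pointed X. *)
Notation borel X := (g_sigma_algebraType (@open X)).

Section radon_probability.
Context (R : realType) (X : ptopologicalType).

Definition radon (mu : {measure set (borel X) -> \bar R}) : Prop :=
  forall B : set (borel X), measurable B ->
    mu B = ereal_sup [set mu K | K in [set K : set X | K `<=` B /\ compact K]].

(* A measure of the library is a function on all the subsets of X, whose values
   on the non-Borel sets are unconstrained. Setting them to 0 makes two
   elements of radonProbability equal as soon as they agree on Borel sets. *)
Record radonProbability := RadonProbability {
  radon_measure :> probability (borel X) R ;
  radon_measureP : radon radon_measure ;
  radon_measure_out : forall B : set (borel X),
    ~ measurable B -> radon_measure B = 0%E }.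

Definition boundedContinuous : Type :=
  {g : X -> R | continuous g /\ bounded_fun g}.

Definition expect (g : boundedContinuous) (mu : radonProbability) : R :=
  \int[mu]_x (sval g x).

HB.instance Definition _ := gen_eqMixin radonProbability.
HB.instance Definition _ := gen_choiceMixin radonProbability.

HB.instance Definition _ := Topological.copy radonProbability
  (sup_topology (fun g : boundedContinuous =>
     Topological.class (initial_topology (expect g)))).

End radon_probability.

(* Main.v *)
Require Import Defs.
From mathcomp Require Import all_boot all_order all_algebra.
From mathcomp Require Import finmap lra.
From mathcomp Require Import all_classical all_reals all_analysis.
Import Order.TTheory GRing.Theory Num.Theory.
Import numFieldNormedType.Exports.
Local Open Scope classical_set_scope.
Local Open Scope ring_scope.

Set Implicit Arguments.
Unset Strict Implicit.
Unset Printing Implicit Defensive.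

(** 
Fix c in ]0, 1[ with 1 - eps < c, and a complete sieve with indices A_n and sets U_a;
for F in A_n let U_F be the union of the U_a with a in F.  The compact set
attached to mu is obtained by choosing, at every level n, a finite set F_n(mu)
of indices with mu(U_{F_n(mu)}) > c, and by intersecting the closures of the
sets H_n(mu) = U_{F_n(mu)}.  Three properties of the choice make this work.

- It is coherent: the projection maps F_{n+1}(mu) into F_n(mu).  An ultrafilter
  that contains every H_n(mu) then contains, at each level, some U_a with a in
  F_n(mu); by Konig's lemma (konig) such indices can be chosen along one branch
  of the sieve, and completeness gives a cluster point (sieve_cluster).
  Regularity of X extends this to filters that contain only the closures of the
  H_n(mu) (cluster_closure).  Hence the intersection phi(mu) of the closures is
  compact, and each open set around phi(mu) contains one of the closures.

- It is upper semi-continuous: F_n(nu) is contained in F_n(mu) for nu near mu.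
  Together with the preceding point this makes phi upper semi-continuous.

- It is heavy: mu(H_n(mu)) > c for all n, so mu(phi(mu)) >= c by continuity
  from above.

The choice comes from paracompactness.  As X is completely regular, the
condition mu(U) > c is open in mu for each open U (open_measure_gt), and inner
regularity allows an open union of mass > c to be replaced by a finite
subunion (radon_finite_subcover).  This gives a locally finite open cover V_0
of Z whose members B carry a finite set F_B of indices with nu(U_{F_B}) > c on
B, and then successive refinements V_{n+1} of V_n whose sets of indices project
into those of V_n: the sieve equation expresses U_{F_B} as a union of sets of
the next level, of the same mass (heavy_cover0, heavy_coverS).  Finally F_n(mu)
collects the F_B for all B in V_n whose closure contains mu.  Using closures is
what makes F_n upper semi-continuous, by local finiteness, and it preserves
coherence, because B included in A entails the inclusion of the closures.
*)

(** * Finite choices and branches of trees *)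

Lemma filter_bigcap_finite (T I : Type) (F : set_system T) (D : set I)
    (A : I -> set T) : Filter F -> finite_set D ->
  (forall i, D i -> F (A i)) -> F (\bigcap_(i in D) A i).
Proof.
move=> FF finD FA.
have [E DE] := (@finite_fsetP {classic I} D).1 finD.
rewrite DE; apply: (@filter_bigI T {classic I}) => i iE.
by apply: FA; rewrite DE.
Qed.

(** Otherwise the ultrafilter contains the complements of all the [A i], hence
their finite intersection, which is disjoint from the union. *)
Lemma ultra_bigcup_finite (T I : Type) (F : set_system T) (D : set I)
    (A : I -> set T) : UltraFilter F -> finite_set D ->
  F (\bigcup_(i in D) A i) -> exists2 i, D i & F (A i).
Proof.
move=> FU finD FDA; apply: contrapT => noi.
have FC : F (\bigcap_(i in D) ~` A i).
  apply: filter_bigcap_finite => // i Di.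
  by have [FAi|//] := in_ultra_setVsetC (A i) FU; case: noi; exists i.
by have [x [[i Di Aix] /(_ i Di)]] := filter_ex (filterI FDA FC).
Qed.

(** An ultrafilter on [nat] finer than [\oo] selects one [i] that serves for
arbitrarily large [k], and by monotonicity for all [k]. *)
Lemma finite_pigeonhole (I : Type) (D : set I) (Q : nat -> I -> Prop) :
  finite_set D -> (forall k i, Q k.+1 i -> Q k i) ->
  (forall k, exists2 i, D i & Q k i) -> exists2 i, D i & forall k, Q k i.
Proof.
move=> finD Qdec DQ.
have Qmono k m i : (k <= m)%N -> Q m i -> Q k i.
  move=> /subnK <-; elim: (m - k)%N => [//|j IHj].
  by rewrite addSn => /Qdec.
have [G [GU ooG]] := @ultraFilterLemma _ \oo _.
have [|i Di GQi] := @ultra_bigcup_finite _ _ G D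
    (fun i => [set k | Q k i]) GU finD.
  by apply: filterS (@filterT _ G _) => k _; have [i] := DQ k; exists i.
exists i => // k.
have Gk : G [set m | (k <= m)%N] by apply: ooG; exists k.
by have [m [km /Qmono]] := filter_ex (filterI Gk GQi); apply.
Qed.

Lemma dependent_choice_nat (T : nat -> Type)
    (r : forall n, T n -> T n.+1 -> Prop) (x0 : T 0%N) :
  (forall n x, exists y, r n x y) ->
  exists f : forall n, T n, forall n, r n (f n) (f n.+1).
Proof.
move=> rex; pose next n x := projT1 (cid (rex n x)).
exists (fix f n := if n is m.+1 then next m (f m) else x0) => n /=.
by rewrite /next; case: cid.
Qed.

(** Konig's lemma for a tree given by its levels.  The nodes with descendants at
every depth form a subtree without dead ends: among the finitely many children
of such a node, the pigeonhole principle finds one of the same kind. *)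
Lemma konig (T : nat -> Type) (p : forall n, T n.+1 -> T n)
    (A : forall n, set (T n)) :
  (forall n, finite_set (A n)) -> (forall n, A n !=set0) ->
  (forall n x, A n.+1 x -> A n (p n x)) ->
  exists f : forall n, T n, forall n, A n (f n) /\ p n (f n.+1) = f n.
Proof.
move=> finA A0 pA.
(* [ext k n x]: some chain of length [k] inside [A] ends above [x]. *)
pose ext := fix ext k n : T n -> Prop := fun x => A n x /\
  if k is j.+1 then exists2 y, p n y = x & ext j n.+1 y else True.
have extA k n x : ext k n x -> A n x by case: k => [|k] [].
have extS k : forall n x, ext k.+1 n x -> ext k n x.
  elim: k => [|k IHk] n x [Ax [y yx ey]]; first by split.
  by split=> //; exists y => //; exact: IHk.
have ext_ex k : forall n, exists2 x, A n x & ext k n x.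
  elim: k => [|k IHk] n; first by have [x Ax] := A0 n; exists x.
  have [y Ay ey] := IHk n.+1.
  by exists (p n y); [exact: pA|split; [exact: pA|exists y]].
pose good n := {x : T n | forall k, ext k n x}.
have [x0 _ g0] := @finite_pigeonhole (T 0%N) (A 0%N) (ext^~ 0%N)
  (finA 0%N) (fun k => @extS k 0%N)
  (fun k => ext_ex k 0%N).
have [|f fp] := @dependent_choice_nat good
  (fun n x y => p n (sval y) = sval x) (exist _ x0 g0).
  move=> n [x gx].
  have [||y [_ yx] ey] := @finite_pigeonhole (T n.+1)
      (A n.+1 `&` [set y | p n y = x]) (ext^~ n.+1) _ (fun k => @extS k n.+1).
  - exact: finite_setIl.
  - move=> k; have [_ [y yx ey]] := gx k.+1.
    by exists y => //; split=> //; exact: extA ey.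
  - by exists (exist _ y ey).
exists (fun n => sval (f n)) => n; split; last exact: fp.
exact: extA (svalP (f n) 0%N).
Qed.

(** * Intersections of closures of nonincreasing sets *)

Section closure_chain.
Context (X : topologicalType) (H : nat -> set X).
Hypothesis regX : regular_space X.
Hypothesis Hdec : forall n, H n.+1 `<=` H n.
Hypothesis Hcluster : forall G : set_system X, UltraFilter G ->
  (forall n, G (H n)) -> cluster G !=set0.

Lemma chain_subset m n : (m <= n)%N -> H n `<=` H m.
Proof.
move=> /subnK <-; elim: (n - m)%N => [//|k IHk].
by rewrite addSn; apply: subset_trans IHk; exact: Hdec.
Qed.

(** A filter that contains the [closure (H n)] need not contain the [H n].  Its
open members, however, meet every [H n], so their traces on the [H n] generate
a filter that has a cluster point; in a regular space, a cluster point of the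
open members of a filter is a cluster point of the filter. *)
Lemma cluster_closure (G : set_system X) : ProperFilter G ->
  (forall n, G (closure (H n))) -> cluster G !=set0.
Proof.
move=> GP GH.
pose D := [set Un : set X * nat | open Un.1 /\ G Un.1].
pose B (Un : set X * nat) := Un.1 `&` H Un.2.
have FP : ProperFilter (filter_from D B).
  apply: filter_from_proper.
    apply: filter_from_filter; first by exists (setT, 0%N); split;
      [exact: openT|exact: filterT].
    move=> [U m] [V n] [/= oU GU] [/= oV GV].
    exists (U `&` V, maxn m n); first by split; [exact: openI|exact: filterI].
    move=> x [[Ux Vx] Hx]; split; split => //;
      apply: chain_subset Hx; [exact: leq_maxl|exact: leq_maxr].
  move=> [U n] [/= oU GU].
  have [x [Ux clx]] := filter_ex (filterI GU (GH n)).
  have [y [Hy Uy]] := clx U (open_nbhs_nbhs (conj oU Ux)).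
  by exists y.
have [W [WU FW]] := ultraFilterLemma FP.
have WG U : open U -> G U -> W U.
  by move=> oU GU; apply: FW; exists (U, 0%N) => // x [].
have [|x clWx] := Hcluster WU.
  move=> n; apply: FW; exists (setT, n); last by move=> x [].
  by split; [exact: openT|exact: filterT].
exists x => A N GA Nx.
have [C Cx CN] := @regX x N Nx.
have [[a [Aa Na]]|AN0] := pselect (A `&` N !=set0); first by exists a.
have WC : W (~` closure C).
  apply: WG; first exact/closed_openC/closed_closure.
  apply: filterS GA => a Aa Ca; apply: AN0; exists a; split=> //.
  exact: CN.
have [y [nCy Cy]] := clWx _ _ WC Cx.
by case: nCy; exact: subset_closure.
Qed.

Lemma compact_bigcap_closure : compact (\bigcap_n closure (H n)).
Proof.
move=> G GP GK.
have GH n : G (closure (H n)) by apply: filterS GK => x; exact.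
have [x clx] := cluster_closure GP GH; exists x; split=> // n _.
move: clx; rewrite clusterE => /(_ _ (GH n)).
by rewrite -(closure_id (closure (H n))).1 //; exact: closed_closure.
Qed.

(** Otherwise the sets [closure (H n) `\` U] generate a filter, whose cluster
points lie in the intersection of the closures but outside [U]. *)
Lemma bigcap_closure_subset (U : set X) : open U ->
  \bigcap_n closure (H n) `<=` U -> exists n, closure (H n) `<=` U.
Proof.
move=> oU KU; apply: contrapT => nU.
pose B n := closure (H n) `\` U.
have FP : ProperFilter (filter_from setT B).
  apply: filter_from_proper.
    apply: filter_from_filter; first by exists 0%N.
    move=> m n _ _; exists (maxn m n) => // x [clx nUx].
    by split; split => //; move: clx; apply: closureS;
      apply: chain_subset; [exact: leq_maxl|exact: leq_maxr].
  move=> n _; apply: contrapT => B0; apply: nU; exists n => x clx.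
  by apply: contrapT => nUx; apply: B0; exists x.
have FH n : filter_from setT B (closure (H n)) by exists n => // x [].
have [x clx] := cluster_closure FP FH.
have Ux : U x.
  apply: KU => n _; move: clx; rewrite clusterE => /(_ _ (FH n)).
  by rewrite -(closure_id (closure (H n))).1 //; exact: closed_closure.
have FU : filter_from setT B (~` U) by exists 0%N => // y [].
by have [y []] := clx _ _ FU (open_nbhs_nbhs (conj oU Ux)).
Qed.

End closure_chain.

(** * Clustering along a complete sieve *)

(** The indices [a] in [F n] whose set belongs to [G] form a finitely branching
tree: no level is empty, as [G] is an ultrafilter, and they are stable under
projection, as the sieve sets increase along it.  Completeness applies to a
branch of this tree. *)
Lemma sieve_cluster (X : topologicalType) (S : open_sieve X)
    (F : forall n, set (sieve_index S n)) (G : set_system X) :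
  complete_sieve S ->
  (forall n, finite_set (F n)) ->
  (forall n b, F n.+1 b -> F n (sieve_proj b)) ->
  UltraFilter G -> (forall n, G (\bigcup_(a in F n) sieve_set a)) ->
  cluster G !=set0.
Proof.
move=> cS finF projF GU GF.
have [n|n|n b [Fb Gb]|a aP] := @konig (sieve_index S) (@sieve_proj X S)
    (fun n => F n `&` [set a | G (sieve_set a)]).
- exact: finite_setIl.
- by have [a Fa Ga] := ultra_bigcup_finite GU (finF n) (GF n); exists a.
- split; first exact: projF.
  by apply: filterS Gb => x bx; rewrite sieve_refine; exists b.
apply: (cS a) => [n| |n].
- by have [] := aP n.
- split; first by exists setT; exact: filterT.
  + by move=> A /filter_ex.
  + by move=> A B GA GB; exists (A `&` B) => //; exact: filterI.
- by have [[_ Ga] _] := aP n; exists (sieve_set (a n)).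
Qed.

(** * Locally finite covers *)

Definition locally_finite (T : topologicalType) (V : set (set T)) : Prop :=
  forall x : T, exists2 N : set T, nbhs x N &
    finite_set [set B | V B /\ B `&` N !=set0].

(** A neighbourhood of [x] that meets finitely many members can be shrunk so as
to avoid those closures of these members that miss [x]. *)
Lemma locally_finite_closure (T : topologicalType) (V : set (set T)) (x : T) :
  locally_finite V ->
  finite_set [set B | V B /\ closure B x] /\
  \forall y \near x, forall B, V B -> closure B y -> closure B x.
Proof.
move=> /(_ x)[N Nx finN]; split.
  by apply: sub_finite_set finN => B [VB /(_ N Nx)].
have cN : nbhs x (\bigcap_(B in [set B | V B /\ B `&` N !=set0])
    [set y | closure B y -> closure B x]).
  apply: filter_bigcap_finite finN _ => B [VB _].
  have [Bx|nBx] := pselect (closure B x); first by apply: filterE => y.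
  apply: filterS (_ : nbhs x (~` closure B)); first by move=> y nBy /nBy.
  apply: open_nbhs_nbhs; split=> //; exact/closed_openC/closed_closure.
near=> y => B VB By.
have Ny : nbhs y N by near: y; exact: nbhs_interior.
have cNy : (\bigcap_(B in [set B | V B /\ B `&` N !=set0])
    [set y | closure B y -> closure B x]) y by near: y.
by apply: (cNy) (By); split=> //; exact: By.
Unshelve. all: by end_near. Qed.

(** Paracompactness in the form of a choice of labels: if locally some label [i]
satisfies [P], and [P] passes to smaller sets, then labels can be assigned to
the members of a locally finite open cover. *)
Lemma paracompact_choice (T : topologicalType) (I : Type)
    (P : set T -> set I -> Prop) :
  paracompact T -> (forall A B i, A `<=` B -> P B i -> P A i) ->
  (forall x, exists A i, [/\ open A, A x & P A i]) ->
  exists V : set (set T), exists F : set T -> set I,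
    [/\ V `<=` open, \bigcup_(B in V) B = [set: T], locally_finite V &
        forall B, V B -> P B (F B)].
Proof.
move=> pT Pdown Pex.
have [||V [Vo Vcov VU Vlf]] := pT [set A | open A /\ exists i, P A i].
- by move=> A [].
- rewrite -subTset => x _; have [A [i [oA Ax PA]]] := Pex x.
  by exists A => //; split=> //; exists i.
have /choice[F FP] : forall B, exists i, V B -> P B i.
  move=> B; have [VB|nVB] := pselect (V B); last by exists set0.
  by have [A [_ [i PA]] BA] := VU B VB; exists i => _; exact: Pdown PA.
by exists V, F.
Qed.

(** * Radon probability measures and open sets *)

Section radon.
Context (R : realType) (X : ptopologicalType).
Implicit Types (mu : radonProbability R X) (A U K : set X).

Lemma borel_open U : open U -> measurable (U : set (borel X)).
Proof. exact: sub_sigma_algebra. Qed.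

Lemma borel_closed A : closed A -> measurable (A : set (borel X)).
Proof.
move=> clA; rewrite -(setCK A).
by apply: measurableC; apply: borel_open; exact: closed_openC.
Qed.

Lemma radon_compact mu U (c : R) : open U -> (c%:E < mu U)%E ->
  exists K, [/\ K `<=` U, compact K & (c%:E < mu K)%E].
Proof.
move=> oU; rewrite (radon_measureP mu (borel_open oU)).
by move=> /ereal_sup_gt[_ [K [KU cK] <-] cmuK]; exists K.
Qed.

Lemma continuous_borel (g : X -> R) : continuous g ->
  measurable_fun [set: borel X] (g : borel X -> R).
Proof.
move=> cg.
apply: (measurability _ (measurable_realfun.RGenOpens.measurableE R)).
move=> _ [_ [a [b ->] <-]]; rewrite setTI; apply: borel_open.
by move/continuousP : cg; apply; exact: interval_open.
Qed.

Lemma expect_continuous (g : boundedContinuous R X) : continuous (expect g).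
Proof.
move=> mu A /(@initial_continuous _ _ (expect g)) Amu.
pose Tg (f : boundedContinuous R X) :=
  Topological.class (initial_topology (expect f)).
have mu_sup := (@cvg_sup _ _ Tg (nbhs mu) mu (nbhs_filter mu)).1.
exact: (mu_sup (@cvg_id _ _) g).
Qed.

(** The sets on which such a [g] can be found are stable under finite unions, by
taking maxima, and complete regularity provides one around each point of
[K]. *)
Lemma compact_open_separation K U : completely_regular_space X ->
  compact K -> open U -> K `<=` U ->
  exists g : X -> R, [/\ continuous g, forall x, 0 <= g x <= 1,
    forall x, K x -> g x = 1 & forall x, ~ U x -> g x = 0].
Proof.
move=> crX cK oU KU.
pose sep (A : set X) := exists g : X -> R,
  [/\ continuous g, forall x, 0 <= g x <= 1,
    forall x, A x -> g x = 1 & forall x, ~ U x -> g x = 0].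
have sep0 : sep set0.
  by exists (cst 0); split=> // x; [exact: cvg_cst|rewrite lexx ler01].
have sepU A B : sep A -> sep B -> sep (A `|` B).
  move=> [f [cf f01 fA fU]] [g [cg g01 gB gU]].
  exists (fun x => Num.max (f x) (g x)); split.
  - by move=> x; apply: (@continuous_max R X f g); [exact: cf|exact: cg].
  - move=> x; have /andP[f0 f1] := f01 x; have /andP[g0 g1] := g01 x.
    by rewrite le_max f0 ge_max f1 g1.
  - move=> x [/fA|/gB] ->; first by rewrite max_l//; have /andP[] := g01 x.
    by rewrite max_r//; have /andP[] := f01 x.
  - by move=> x nUx; rewrite fU// gU// maxxx.
have sep_nbhs x : exists A : set X, K x -> [/\ open A, A x & sep A].
  have [Kx|] := pselect (K x); last by exists set0.
  have /(@uniform_separatorP _ R)[f [cf f01 fx fU]] :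
      uniform_separator [set x] (~` U).
    by apply: crX; [exact: open_closedC|move=> /(_ (KU _ Kx))].
  have fx0 : f x = 0 by apply: fx; exists x.
  have fU1 y : ~ U y -> f y = 1 by move=> nUy; apply: fU; exists y.
  exists [set y | f y < 2^-1] => _; split.
  - by apply: (@open_comp _ _ f [set r | r < 2^-1]);
      [move=> y _; exact: cf|exact: open_lt].
  - by rewrite /= fx0 invr_gt0.
  (* [f] is 0 at [x] and 1 off [U]; the truncation is 1 where [f] < 1/2. *)
  exists (fun y => Num.min 1 (2 * (1 - f y))); split.
  - move=> y; apply: (@continuous_min R X (cst 1) (fun z => 2 * (1 - f z)));
      first exact: cvg_cst.
    apply: cvgM; first exact: cvg_cst.
    by apply: cvgB; [exact: cvg_cst|exact: cf].
  - move=> y; have /= : `[0, 1]%classic (f y) by apply: f01; exists y.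
    rewrite in_itv/= => /andP[_ f1].
    by rewrite le_min ler01 ge_min lexx/= andbT mulr_ge0 ?subr_ge0.
  - move=> y /= fy; rewrite min_l//.
    by rewrite -ler_pdivrMl// mulr1 lerBrDr -lerBrDl (le_trans (ltW fy))//;
      lra.
  - by move=> y /fU1 ->; rewrite subrr mulr0 min_r.
have /choice[B BP] := sep_nbhs.
have := cK; rewrite compact_cover => /(_ X K B) [x Kx|x Kx|D DK].
- by have [] := BP x Kx.
- by exists x => //; have [] := BP x Kx.
move=> KD; suff [g [cg g01 gD gU]] : sep (cover [set` D] B).
  by exists g; split=> // z /KD /gD.
rewrite /cover bigcup_fset big_seq; elim/big_ind : _ => // x /DK/set_mem Kx.
by have [] := BP x Kx.
Qed.

Lemma unit_range_bounded (T : Type) (g : T -> R) :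
  (forall x, 0 <= g x <= 1) -> bounded_fun g.
Proof.
move=> g01; exists 1; split=> // M M1 x _ /=; have /andP[g0 g1] := g01 x.
by rewrite ger0_norm// (le_trans g1)// ltW.
Qed.

Lemma unit_range_integrable mu (g : X -> R) : continuous g ->
  (forall x, 0 <= g x <= 1) -> (radon_measure mu).-integrable setT (EFin \o g).
Proof.
move=> cg g01; apply: measurable_bounded_integrable => //.
- by rewrite ltey_eq fin_num_measure.
- exact: continuous_borel.
- exact: unit_range_bounded.
Qed.

(** If mu(U) > c, inner regularity gives a compact [K] in [U] with mu(K) > c.
For a continuous [g] with \1_K <= g <= \1_U, the integral of [g] exceeds [c] at
mu, hence near mu, and it bounds the mass of [U] from below. *)
Lemma open_measure_gt (U : set X) (c : R) : completely_regular_space X ->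
  hausdorff_space X -> open U ->
  open [set mu : radonProbability R X | (c%:E < mu U)%E].
Proof.
move=> crX hX oU; rewrite openE => mu /= /(radon_compact oU)[K [KU cK cmuK]].
have [g [cg g01 gK gU]] := compact_open_separation crX cK oU KU.
pose G : boundedContinuous R X :=
  exist _ g (conj cg (unit_range_bounded g01)).
have mK : measurable (K : set (borel X)).
  by apply: borel_closed; exact: compact_closed.
have mU := borel_open oU.
have int1 nu A : measurable (A : set (borel X)) ->
    (radon_measure nu).-integrable setT (EFin \o (\1_A : borel X -> R)).
  by move=> mA; exact: integrable_indic.
have intE (nu : radonProbability R X) (A : set (borel X)) : measurable A ->
    \int[nu]_x (\1_A x : R) = fine (nu A).
  by move=> mA; rewrite /Rintegral integral_indic// setIT.
have muG : c < expect G mu.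
  rewrite -lte_fin; apply: lt_le_trans cmuK _.
  rewrite -(@fineK _ (mu K)) ?fin_num_measure// lee_fin -intE//.
  apply: le_Rintegral => //; [exact: int1|exact: unit_range_integrable|].
  move=> x _; rewrite indicE /=; have [/set_mem/gK ->//|_] := boolP (x \in K).
  by have /andP[] := g01 x.
have : nbhs mu (expect G @^-1` [set r | c < r]).
  by apply: expect_continuous; apply: open_nbhs_nbhs; split=> //;
    exact: open_gt.
apply: filterS => nu /= cnu.
rewrite -(@fineK _ (nu U)) ?fin_num_measure// lte_fin -intE//.
apply: lt_le_trans cnu _.
apply: le_Rintegral => //; [exact: unit_range_integrable|exact: int1|].
move=> x _; rewrite indicE; have [_|/negP xU] := boolP (x \in U).
  by have /andP[] := g01 x.
by rewrite /= gU// => Ux; apply: xU; exact: mem_set.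
Qed.

(** A compact subset of the union of mass > c is covered by finitely many of
the [U i]. *)
Lemma radon_finite_subcover mu (I : Type) (D : set I) (U : I -> set X) (c : R) :
  hausdorff_space X -> (forall i, open (U i)) ->
  (c%:E < mu (\bigcup_(i in D) U i))%E ->
  exists E : set I, [/\ finite_set E, E `<=` D &
    (c%:E < mu (\bigcup_(i in E) U i))%E].
Proof.
move=> hX oU cD.
have [|K [KD cK cmuK]] := radon_compact _ cD; first exact: bigcup_open.
have := cK; rewrite compact_cover => /(_ {classic I} D U) [//|//|E ED KE].
exists [set` E]; split.
- by apply/(@finite_fsetP {classic I}); exists E.
- by move=> i /ED/set_mem.
- apply: lt_le_trans cmuK _; apply: le_measure => //; rewrite inE.
  + by apply: borel_closed; exact: compact_closed.
  + by apply: borel_open; exact: bigcup_open.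
Qed.

End radon.

(** * Covers labelled by finite sets of sieve indices *)

Section usco_construction.
Context (R : realType) (X : ptopologicalType) (S : open_sieve X).
Context (Z : set (radonProbability R X)) (c : R).
Hypothesis hX : hausdorff_space X.
Hypothesis crX : completely_regular_space X.
Hypothesis cS : complete_sieve S.
Hypothesis pcZ : paracompact Z.

Definition sieve_union n (F : set (sieve_index S n)) : set X :=
  \bigcup_(a in F) sieve_set a.

Lemma open_sieve_union n (F : set (sieve_index S n)) : open (sieve_union F).
Proof. by apply: bigcup_open => a _; exact: sieve_open. Qed.

Definition heavy n (B : set Z) (F : set (sieve_index S n)) : Prop :=
  finite_set F /\
  forall mu : Z, B mu -> (c%:E < set_val mu (sieve_union F))%E.

(** The second component labels the members of the cover; only its values on
these members matter. *)
Definition heavy_cover n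
    (VF : set (set Z) * (set Z -> set (sieve_index S n))) : Prop :=
  [/\ VF.1 `<=` open, \bigcup_(B in VF.1) B = [set: Z], locally_finite VF.1 &
      forall B, VF.1 B -> heavy B (VF.2 B)].

Definition refines n (VF : set (set Z) * (set Z -> set (sieve_index S n)))
    (WG : set (set Z) * (set Z -> set (sieve_index S n.+1))) : Prop :=
  forall B, WG.1 B -> exists A, [/\ VF.1 A, B `<=` A &
    forall b, WG.2 B b -> VF.2 A (sieve_proj b)].

Lemma heavy_nbhs n (D : set (sieve_index S n)) (mu : Z) :
  (c%:E < set_val mu (sieve_union D))%E ->
  exists (B : set Z) F, [/\ open B, B mu, F `<=` D & heavy B F].
Proof.
move=> /(radon_finite_subcover hX (@sieve_open X S n))[F [finF FD cF]].
exists (set_val @^-1` [set nu : radonProbability R X |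
  (c%:E < nu (sieve_union F))%E]), F; split=> //.
apply: open_comp => [nu _|]; first exact: initial_continuous.
exact: open_measure_gt (open_sieve_union F).
Qed.

Lemma heavyS n (A B : set Z) (F : set (sieve_index S n)) :
  A `<=` B -> heavy B F -> heavy A F.
Proof. by move=> AB [finF BF]; split=> // mu /AB/BF. Qed.

Lemma heavy_cover0 : c < 1 ->
  exists VF : set (set Z) * (set Z -> set (sieve_index S 0%N)), heavy_cover VF.
Proof.
move=> c1.
have [|mu|V [F VF]] := @paracompact_choice _ (sieve_index S 0%N) (@heavy 0) pcZ.
- exact: heavyS.
- have [|B [F [oB Bmu _ BF]]] := @heavy_nbhs 0 setT mu; last by exists B, F.
  rewrite /sieve_union sieve_cover.
  by rewrite (_ : set_val mu setT = 1%E) ?lte_fin//; exact: probability_setT.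
- by exists (V, F).
Qed.

(** The sieve equation rewrites [sieve_union (VF.2 A)] as the union of the sets
of level [n.+1] whose index projects into [VF.2 A].  Around each point of [A], a
finite part of this union is still heavy; intersecting with [A] yields the
refinement. *)
Lemma heavy_coverS n (VF : set (set Z) * (set Z -> set (sieve_index S n))) :
  heavy_cover VF -> exists WG, heavy_cover WG /\ refines VF WG.
Proof.
move=> [oV covV lfV VFP].
pose P (B : set Z) (G : set (sieve_index S n.+1)) := heavy B G /\
  exists A, [/\ VF.1 A, B `<=` A & forall b, G b -> VF.2 A (sieve_proj b)].
have [||W [G [oW covW lfW WGP]]] := @paracompact_choice _ _ P pcZ.
- move=> A B G AB [hG [C [VC BC GC]]]; split; first exact: heavyS hG.
  by exists C; split=> //; exact: subset_trans BC.
- move=> mu; have [A VA Amu] : (\bigcup_(B in VF.1) B) mu by rewrite covV.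
  have [_ /(_ mu Amu) cmu] := VFP A VA.
  pose D := [set b | VF.2 A (@sieve_proj _ S n b)].
  have FD : sieve_union (VF.2 A) = sieve_union D.
    apply/seteqP; split=> [x [a Fa]|x [b Db bx]].
      rewrite sieve_refine => -[b /= ba bx]; exists b => //.
      by rewrite /D /= ba.
    by exists (sieve_proj b) => //; rewrite sieve_refine; exists b.
  have [|B [G [oB Bmu GD BG]]] := @heavy_nbhs n.+1 D mu; first by rewrite -FD.
  exists (B `&` A), G; split; [by apply: openI => //; exact: oV|by []|].
  split; first exact: heavyS BG.
  by exists A; split=> // b /GD.
- exists (W, G); split; first by split=> // B /WGP[].
  by move=> B /WGP[].
Qed.

(** * The usco mapping of a sequence of refining covers *)

Section kept_indices.
Context (VF : forall n, set (set Z) * (set Z -> set (sieve_index S n))).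
Hypothesis VF_heavy : forall n, heavy_cover (VF n).
Hypothesis VF_refines : forall n, refines (VF n) (VF n.+1).

(** The labels of all the members whose closure contains [mu], and not only of
those that contain [mu]: this makes [kept n] upper semi-continuous. *)
Definition kept n (mu : Z) : set (sieve_index S n) :=
  \bigcup_(B in [set B | (VF n).1 B /\ closure B mu]) (VF n).2 B.
Arguments kept : clear implicits.

Lemma finite_kept n mu : finite_set (kept n mu).
Proof.
have [_ _ lfV VFP] := VF_heavy n.
apply: bigcup_finite; first by have [] := locally_finite_closure mu lfV.
by move=> B [/VFP[]].
Qed.

Lemma kept_proj n mu b : kept n.+1 mu b -> kept n mu (sieve_proj b).
Proof.
move=> [B [/VF_refines[A [VA BA GF]] clB] /GF Fb].
by exists A => //; split=> //; exact: closureS clB.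
Qed.

Lemma kept_near n mu : \forall nu \near mu, kept n nu `<=` kept n mu.
Proof.
have [_ _ lfV _] := VF_heavy n; have [_] := locally_finite_closure mu lfV.
apply: filterS => nu nuV a [B [VB Bnu] Fa].
by exists B => //; split=> //; exact: nuV.
Qed.

Lemma kept_gt n (mu : Z) : (c%:E < set_val mu (sieve_union (kept n mu)))%E.
Proof.
have [_ covV _ VFP] := VF_heavy n.
have [B VB Bmu] : (\bigcup_(B in (VF n).1) B) mu by rewrite covV.
have [_ /(_ mu Bmu) cmu] := VFP B VB.
apply: lt_le_trans cmu _; apply: le_measure; rewrite ?inE.
- by apply: borel_open; exact: open_sieve_union.
- by apply: borel_open; exact: open_sieve_union.
- move=> x [a Fa ax]; exists a => //; exists B => //; split=> //.
  exact: subset_closure.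
Qed.

Let H (mu : Z) n := sieve_union (kept n mu).

Lemma kept_union_dec mu n : H mu n.+1 `<=` H mu n.
Proof.
move=> x [b /kept_proj Fb bx]; exists (sieve_proj b) => //.
by rewrite sieve_refine; exists b.
Qed.

Definition kept_core (mu : Z) : set X := \bigcap_n closure (H mu n).

Lemma kept_cluster mu (G : set_system X) : UltraFilter G ->
  (forall n, G (H mu n)) -> cluster G !=set0.
Proof.
move=> GU; apply: (sieve_cluster cS) => // n; first exact: finite_kept.
exact: kept_proj.
Qed.

Let regX : regular_space X := @completely_regular_regular R X crX.

Lemma compact_kept_core mu : compact (kept_core mu).
Proof.
exact: compact_bigcap_closure regX (@kept_union_dec mu) (@kept_cluster mu).
Qed.

(** If the core at [mu] lies in [U], then so does [closure (H mu n)] for some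
[n], and that closure contains the cores at all points near [mu]. *)
Lemma usc_kept_core : usc kept_core.
Proof.
move=> U oU; rewrite openE => mu /= coreU.
have [n nU] := bigcap_closure_subset regX (@kept_union_dec mu)
  (@kept_cluster mu) oU coreU.
apply: filterS (kept_near n mu) => nu nuF x core_x; apply: nU.
have := core_x n I; apply: closureS => y [a Fa ay].
by exists a => //; exact: nuF.
Qed.

Lemma kept_core_ge (mu : Z) : (c%:E <= set_val mu (kept_core mu))%E.
Proof.
have mH n : measurable (closure (H mu n) : set (borel X)).
  by apply: borel_closed; exact: closed_closure.
have cvg_core : (set_val mu \o (fun n => closure (H mu n))) x @[x --> \oo] -->
    set_val mu (kept_core mu).
  apply: nonincreasing_cvg_mu => //.
  - by rewrite ltey_eq fin_num_measure.
  - exact: bigcapT_measurable.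
  - move=> m n mn; apply/subsetPset/closureS.
    exact: chain_subset (@kept_union_dec mu) _ _ mn.
apply: cvge_ge cvg_core; apply: nearW => n /=.
apply: le_trans (ltW (kept_gt n mu)) _; apply: le_measure; rewrite ?inE //.
- by apply: borel_open; exact: open_sieve_union.
- exact: subset_closure.
Qed.

End kept_indices.

(** The values are nonempty because their mass is at least [c], which is
positive. *)
Lemma usco_ge : 0 < c -> c < 1 ->
  exists phi : Z -> set X, usco phi /\
    forall mu : Z, (c%:E <= set_val mu (phi mu))%E.
Proof.
move=> c0 c1.
pose T n := {VF : set (set Z) * (set Z -> set (sieve_index S n)) |
  heavy_cover VF}.
have [VF0 VF0P] := heavy_cover0 c1.
have [|f fP] := @dependent_choice_nat T
    (fun n x y => refines (sval x) (sval y)) (exist _ VF0 VF0P).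
  move=> n [VF VFP]; have [WG [WGP VWG]] := heavy_coverS VFP.
  by exists (exist _ WG WGP).
pose VF n := sval (f n).
have VFP n : heavy_cover (VF n) := svalP (f n).
exists (kept_core VF); split; last by move=> mu; exact: kept_core_ge.
split; [|exact: usc_kept_core|exact: compact_kept_core].
move=> mu; apply/set0P/eqP => core0.
have := kept_core_ge VFP fP mu.
by rewrite core0 measure0 lee_fin leNgt c0.
Qed.

End usco_construction.

Theorem theorem3p1 (R : realType) (X : ptopologicalType)
  (hX : hausdorff_space X) (crX : completely_regular_space X)
  (scX : sieve_complete X)
  (Z : set (radonProbability R X)) (pcZ : paracompact Z)
  (eps : R) (eps_gt0 : 0 < eps) :
  exists phi : Z -> set X,
    usco phi /\ forall mu : Z, (set_val mu (~` phi mu) < eps%:E)%E.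
Proof.
have [S cS] := scX.
(* Bounding [eps] by 1 keeps [1 - e] positive, as [usco_ge] requires. *)
pose e := Num.min eps 1 / 2.
have e0 : 0 < e by rewrite divr_gt0// lt_min eps_gt0 ltr01.
have e1 : e < 1.
  by rewrite ltr_pdivrMr// mul1r (@le_lt_trans _ _ 1)// ?ge_min ?lexx ?orbT//
    ltr1n.
have eeps : e < eps.
  rewrite ltr_pdivrMr// (@le_lt_trans _ _ eps)// ?ge_min ?lexx//.
  by rewrite ltr_pMr// ltr1n.
have [||phi [uphi phige]] := usco_ge (c := 1 - e) hX crX cS pcZ.
- by rewrite subr_gt0.
- by rewrite ltrBlDr ltrDl.
exists phi; split=> // mu.
have mphi : measurable (phi mu : set (borel X)).
  by apply: borel_closed; apply: compact_closed => //; have [] := uphi.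
have -> : set_val mu (~` phi mu) = (1 - set_val mu (phi mu))%E.
  exact: probability_setC.
have := phige mu; rewrite -(@fineK _ (set_val mu (phi mu))) ?fin_num_measure//.
rewrite -EFinB lee_fin lte_fin => phi_ge.
by rewrite (@le_lt_trans _ _ e)// lerBlDl -lerBlDr.
Qed.
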